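(* Let $\lambda$ be any shape (possibly skew) with $n\ge 1$ boxes. Let $\mathrm{CC}$ be the set of connected components of $\lambda$ and let $cc=|\mathrm{CC}|$. (a) If $\lambda$ is not a broken border strip, then $\Delta^{(k)}(\lambda)=0$ for all $0\le k\le r-1$. (b) If $\lambda$ is a broken border strip, then $$\Delta^{(0)}(\lambda)=(q-q^{-1})^{cc-1}\prod_{bs\in\mathrm{CC}}q^{c(bs)-1}(-q^{-1})^{r(bs)-1},$$ and, for $1\le k\le r-1$, $$\Delta^{(k)}(\lambda)=(-q+q^{-1})^{cc-1}\Big(\prod_{s\in\mathrm{SC}}\mathrm{ct}(s)\Big)\Big(\prod_{d\in\mathrm{DC}}\mathrm{ct}(d)^{-1}\Big)\Big(\sum_{t=0}^{|\mathrm{DC}|}(-1)^te_t(\mathrm{ct}(\mathrm{DC}))\,h_{k-t-cc}(\mathrm{ct}(\mathrm{SC}))\Big)\prod_{bs\in\mathrm{CC}}q^{c(bs)-1}(-q^{-1})^{r(bs)-1}.$$ Here $\mathrm{SC}$ and $\mathrm{DC}$ are the sets of sharp corners and dull corners of $\lambda$, respectively; for a border strip $bs$, $r(bs)$ is its number of rows and $c(bs)$ its number of columns; $e_t(\mathrm{ct}(\mathrm{DC}))$ is the elementary symmetric function in the variables $\{\mathrm{ct}(d):d\in\mathrm{DC}\}$ and $h_{j}(\mathrm{ct}(\mathrm{SC}))$ is the homogeneous symmetric function in the variables $\{\mathrm{ct}(s):s\in\mathrm{SC}\}$.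
   Context: Let $r$ be a positive integer and let $q,u_1,\ldots,u_r$ be indeterminates; all values lie in $\mathbb{C}(u_1,\ldots,u_r,q)$. Partitions are identified with Ferrers diagrams, rows and columns labeled as for matrices; position $(i,j)$ means row $i$, column $j$. An $r$-partition is an $r$-tuple of partitions; for $r$-partitions $\nu\subseteq\mu$ (componentwise), $\mu/\nu$ is the $r$-skew shape with components the skew diagrams $\mu^{(i)}/\nu^{(i)}$. A shape is an $r$-partition or an $r$-skew shape. A standard tableau $L$ of a shape $\lambda$ with $n$ boxes is a filling of its boxes with $1,\ldots,n$, each once, increasing left to right along rows and down columns of each component; $\mathcal{L}(\lambda)$ is the set of these; $L(k)$ is the box containing $k$. The content of a box $b$ in position $(i,j)$ of the $k$-th component is $\mathrm{ct}(b)=u_kq^{2(j-i)}$. For a standard tableau $L$ with $n$ boxes, $(T_i)_{LL}=\dfrac{q-q^{-1}}{1-\mathrm{ct}(L(i-1))/\mathrm{ct}(L(i))}$ for $2\le i\le n$, and $\Delta^{(k)}(L)=\mathrm{ct}(L(1))^k\,(T_2)_{LL}\cdots(T_n)_{LL}$ for $0\le k\le r-1$. For a shape $\lambda$, $\Delta^{(k)}(\lambda)=\sum_{L\in\mathcal{L}(\lambda)}\Delta^{(k)}(L)$. Connectedness of a shape is with respect to boxes of the same component of the $r$-tuple sharing an edge. A shape is a border strip if it is connected and contains no $2\times2$ block of boxes; it is a broken border strip if it contains no $2\times 2$ block of boxes (so it is a union of connected components, each a border strip). A sharp corner is a box with no box directly above it and no box directly to its left. A dull corner is a box that has a box directly to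 its left and a box directly above it but no box directly northwest of it. Conventions: $h_0=e_0=1$ and $h_j=0$ for $j<0$. *)

(* Defs.v *)
From HB Require Import structures.
From mathcomp Require Import all_boot all_order all_algebra.
From mathcomp Require Import mpoly complex reals.

Set Implicit Arguments.
Unset Strict Implicit.
Unset Printing Implicit Defensive.

Import GRing.Theory.

Definition is_partition (p : seq nat) : bool := sorted geq p && (0 \notin p).

(* An r-partition is the case where every [inner k] is empty. *)
Record rshape (r : nat) := RShape {
  outer : 'I_r -> seq nat;
  inner : 'I_r -> seq nat;
  outer_partition : forall k, is_partition (outer k);
  inner_partition : forall k, is_partition (inner k);
  inner_sub_outer : forall k i, nth 0 (inner k) i <= nth 0 (outer k) i
}.

(* (k, (i, j)): position (i, j) of component k; components, rows and columns
   are numbered from 0. *)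
Definition cell (r : nat) : Type := ('I_r * (nat * nat))%type.

Definition in_shape r (lam : rshape r) (c : cell r) : bool :=
  nth 0 (inner lam c.1) c.2.1 <= c.2.2 < nth 0 (outer lam c.1) c.2.1.

Definition cells r (lam : rshape r) : seq (cell r) :=
  filter (in_shape lam)
    [seq (k, ij) | k <- enum 'I_r,
                   ij <- [seq (i, j) | i <- iota 0 (size (outer lam k)),
                                       j <- iota 0 (nth 0 (outer lam k) i)]].

Lemma mem_cells r (lam : rshape r) (c : cell r) :
  (c \in cells lam) = in_shape lam c.
Proof.
rewrite mem_filter andb_idr //; case: c => k [i j] /andP[/= _ ltj].
apply/allpairsPdep; exists k, (i, j); split=> //; first by rewrite mem_enum.
apply/allpairsPdep; exists i, j; split=> //; rewrite mem_iota //= add0n.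
by rewrite ltnNge; apply/negP => /(nth_default 0) e; rewrite e in ltj.
Qed.

Definition box r (lam : rshape r) : finType := seq_sub (cells lam).

Section Shapes.
Variables (r : nat) (lam : rshape r).
Implicit Types b c : box lam.

Definition nboxes : nat := #|{: box lam}|.

Definition comp_of b : 'I_r := (val b).1.
Definition row_of b : nat := (val b).2.1.
Definition col_of b : nat := (val b).2.2.

Definition directly_above c b : bool :=
  [&& comp_of c == comp_of b, (row_of c).+1 == row_of b & col_of c == col_of b].
Definition directly_left c b : bool :=
  [&& comp_of c == comp_of b, row_of c == row_of b & (col_of c).+1 == col_of b].
Definition directly_northwest c b : bool :=
  [&& comp_of c == comp_of b, (row_of c).+1 == row_of b
    & (col_of c).+1 == col_of b].

Definition share_edge : rel (box lam) := fun b c =>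
  [|| directly_above b c, directly_above c b,
      directly_left b c | directly_left c b].

Definition CC : {set {set box lam}} :=
  equivalence_partition (connect share_edge) [set: box lam].

(* a is the top left, b the top right, c the bottom left and d the bottom
   right box of the block. *)
Definition has_2x2_block : bool :=
  [exists a : box lam, exists b : box lam, exists c : box lam,
   exists d : box lam,
     [&& directly_left a b, directly_above a c,
         directly_above b d & directly_left c d]].

Definition broken_border_strip : bool := ~~ has_2x2_block.

Definition nrows (C : {set box lam}) : nat :=
  size (undup [seq row_of b | b in C]).
Definition ncols (C : {set box lam}) : nat :=
  size (undup [seq col_of b | b in C]).

Definition SC : {set box lam} :=
  [set b | ~~ [exists c, directly_above c b]
        && ~~ [exists c, directly_left c b]].

Definition DC : {set box lam} :=
  [set b | [&& [exists c, directly_left c b], [exists c, directly_above c b]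
             & ~~ [exists c, directly_northwest c b]]].

(* The entry of box b is (L b).+1, so that entries run from 1 to nboxes. *)
Definition filling : Type := {ffun box lam -> 'I_nboxes}.

Definition standard (L : filling) : bool :=
  [&& injectiveb L,
      [forall b, forall c,
         [&& comp_of b == comp_of c, row_of b == row_of c & col_of b < col_of c]
           ==> (L b < L c)]
    & [forall b, forall c,
         [&& comp_of b == comp_of c, col_of b == col_of c & row_of b < row_of c]
           ==> (L b < L c)]].

(* L(m); it is never None when L is standard and 1 <= m <= nboxes. *)
Definition box_at (L : filling) (m : nat) : option (box lam) :=
  [pick b | (L b).+1 == m].

End Shapes.

Local Open Scope ring_scope.

(* The field of rational functions C(u_1, ..., u_r, q), where C is R[i]. *)
Definition ratfun (R : realType) (r : nat) : fieldType :=
  {fraction {mpoly R[i][r.+1]}}.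

Definition qvar (R : realType) (r : nat) : ratfun R r :=
  tofrac ('X_ord0 : {mpoly R[i][r.+1]}).

Definition uvar (R : realType) (r : nat) (k : 'I_r) : ratfun R r :=
  tofrac ('X_(lift ord0 k) : {mpoly R[i][r.+1]}).

Section Delta.
Variables (R : realType) (r : nat) (lam : rshape r).
Local Notation F := (ratfun R r).
Local Notation q := (qvar R r).

Definition ct (b : box lam) : F :=
  uvar R (comp_of b) * q ^ (2 * ((col_of b)%:Z - (row_of b)%:Z)).

Definition ct_at (L : filling lam) (m : nat) : F := oapp ct 0 (box_at L m).

Definition T_diag (L : filling lam) (i : nat) : F :=
  (q - q^-1) / (1 - ct_at L i.-1 / ct_at L i).

Definition Delta_tableau (k : nat) (L : filling lam) : F :=
  ct_at L 1 ^+ k * \prod_(2 <= i < (nboxes lam).+1) T_diag L i.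

Definition Delta (k : nat) : F :=
  \sum_(L : filling lam | standard L) Delta_tableau k L.

End Delta.

(* The complete homogeneous symmetric polynomial of degree j in n variables. *)
Definition mhsym (n : nat) (A : nzRingType) (j : int) : {mpoly A[n]} :=
  match j with
  | Posz d => \sum_(m : 'X_{1..n < d.+1} | mdeg m == d) 'X_[m]
  | Negz _ => 0
  end.

Section SymmetricFunctions.
Variables (R : realType) (r : nat) (lam : rshape r) (B : {set box lam}).

Definition ct_vars (i : 'I_#|B|) : ratfun R r := ct R (enum_val i).

Definition e_ct (t : nat) : ratfun R r :=
  (mesym #|B| (ratfun R r) t).@[ct_vars].

Definition h_ct (j : int) : ratfun R r :=
  (mhsym #|B| (ratfun R r) j).@[ct_vars].

End SymmetricFunctions.

(* Main.v *)
(** Writing [x_b] for the content of the box [b] and [L] for a linear extension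
    of the boxes, [Delta^(k)] is [(q - q^-1)^(n-1) * \prod_b x_b] times the sum
    over [L] of [x_(L 1)^(k-1) / \prod_i (x_(L i) - x_(L (i-1)))], a sum of the
    kind evaluated by Greene.  For an order filter [S] of boxes,
      [\sum_L 1 / ((x_(L 1) - z) * \prod_i (x_(L i) - x_(L (i-1))))]
    equals
      [\prod_(nw a b) (x_b - x_a) / \prod_(adj a b) (x_b - x_a)
         * \prod_b (x_b - z) ^ mu b],
    where [mu b] is [-1] at sharp corners, [1] at dull corners and [0] elsewhere.
    This is proved by induction, removing the first box [s] of [L]: the product
    for [S] minus [s] at [z = x_s] is the residue at [z = x_s] of the product for
    [S], so the recursion is a partial fraction expansion.  Diagonal neighbours
    have equal contents, so the product vanishes as soon as there is a 2x2 block.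
    Otherwise, taking [z = 0] gives [Delta^(0)], and the power sums of the
    residues give the alternating sum of [e_t h_(k-t-cc)]. *)
Require Import Defs.
From HB Require Import structures.
From mathcomp Require Import all_boot all_order all_algebra.
From mathcomp Require Import mpoly complex reals.
From mathcomp Require Import zify ring.

Set Implicit Arguments.
Unset Strict Implicit.
Unset Printing Implicit Defensive.

Import GRing.Theory.
Local Open Scope ring_scope.

(** * Interpolation and symmetric functions *)

Lemma poly_interp_inj (F : fieldType) (T : finType) (A : {set T}) (x : T -> F)
    (p p' : {poly F}) :
  {in A &, injective x} -> (size p <= #|A|)%N -> (size p' <= #|A|)%N ->
  {in A, forall s, p.[x s] = p'.[x s]} -> p = p'.
Proof.
move=> xI sp sp' e; apply/eqP; rewrite -subr_eq0; apply/negPn/negP=> nz.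
suff : (#|A| < size (p - p')%R)%N.
  by rewrite ltnNge (leq_trans (size_polyD _ _)) // size_polyN geq_max sp.
rewrite cardE -(size_map x); apply: max_poly_roots => //.
  apply/allP=> _ /mapP[s sA ->]; rewrite mem_enum in sA.
  by rewrite rootE !hornerE e // subrr.
by rewrite map_inj_in_uniq ?enum_uniq // => s s'; rewrite !mem_enum; apply: xI.
Qed.

Lemma size_prod_affine (F : fieldType) (T : finType) (A : {set T}) (u v : T -> F) :
  (size (\prod_(s in A) ((u s)%:P + v s *: 'X))%R <= #|A|.+1)%N.
Proof.
apply: leq_trans (size_poly_prod_leq _ _) _.
have : (\sum_(s in A) size ((u s)%:P + v s *: 'X)%R <= \sum_(s in A) 2)%N.
  apply: leq_sum => s _; apply: leq_trans (size_polyD _ _) _.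
  rewrite geq_max (leq_trans (size_polyC_leq1 _)) //.
  by rewrite (leq_trans (size_scale_leq _ _)) ?size_polyX.
rewrite sum_nat_const => le.
rewrite leq_subLR; apply: leq_trans (_ : (#|A| * 2).+1 <= _)%N => //.
by rewrite muln2 -addnn addnS.
Qed.

(** Lagrange interpolation: after multiplication by [\prod_(b in A) (x b - z)] both sides are
    polynomials in [z] of degree below [#|A|], and at [z = x s] only the summand of [s] survives. *)
Lemma partial_fractions (F : fieldType) (T : finType) (A D : {set T})
    (x : T -> F) (z : F) :
  {in A &, injective x} -> (#|D| < #|A|)%N -> {in A, forall s, x s != z} ->
  \sum_(s in A) (x s - z)^-1 *
     (\prod_(b in A :\ s) (x b - x s)^-1 * \prod_(d in D) (x d - x s)) =
  \prod_(b in A) (x b - z)^-1 * \prod_(d in D) (x d - z).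
Proof.
move=> xI ltDA xz.
pose P (B : {set T}) := \prod_(b in B) ((x b)%:P + (-1) *: 'X).
have PE (B : {set T}) y : (P B).[y] = \prod_(b in B) (x b - y).
  rewrite /P horner_prod; apply: eq_bigr => b _.
  by rewrite !hornerE mulN1r.
have sP (B : {set T}) : (size (P B) <= #|B|.+1)%N by apply: size_prod_affine.
pose w s := \prod_(b in A :\ s) (x b - x s)^-1 * \prod_(d in D) (x d - x s).
have /(congr1 (fun p => p.[z])) : \sum_(s in A) w s *: P (A :\ s) = P D.
  apply: (@poly_interp_inj _ _ A x) => //.
  - apply: leq_trans (size_sum _ _ _) _; apply/bigmax_leqP => s sA.
    apply: leq_trans (size_scale_leq _ _) _; apply: leq_trans (sP _) _.
    by rewrite [X in (_ <= X)%N](cardsD1 s) sA.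
  - exact: leq_trans (sP _) ltDA.
  move=> s sA; rewrite horner_sum (bigD1 s) //= big1 => [|t /andP[tA ts]].
    rewrite addr0 hornerZ !PE /w mulrAC -big_split /= big1 ?mul1r // => b.
    rewrite !inE => /andP[bs bA]; rewrite mulVf // subr_eq0.
    by apply: contra bs => /eqP/xI->.
  rewrite hornerZ PE (bigD1 s) ?inE ?sA ?andbT 1?eq_sym //=.
  by rewrite subrr mul0r mulr0.
rewrite horner_sum PE => <-; rewrite mulr_sumr; apply: eq_bigr => s sA.
rewrite hornerZ PE [RHS]mulrCA -/(w s) mulrC; congr (_ * _).
rewrite (big_setD1 s) //= -mulrA -big_split /= [X in _ * X]big1 ?mulr1 // => b.
by rewrite !inE => /andP[_ bA]; rewrite mulVf // subr_eq0 xz.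
Qed.

Lemma mesym_eval (F : fieldType) (m : nat) (y : 'I_m -> F) :
  \prod_(i < m) (1 - y i *: 'X) =
  \poly_(t < m.+1) ((-1) ^+ t * (mesym m F t).@[y]).
Proof.
pose G i : {poly F} := - (y i *: 'X).
rewrite (eq_bigr (fun i => G i + 1)) => [|i _]; last by rewrite addrC.
rewrite bigA_distr poly_def.
(* Subsets are grouped by size; [inord] is harmless because a subset of ['I_m] has at most [m]
   elements. *)
rewrite (partition_big (fun J : {set 'I_m} => inord #|J| : 'I_m.+1) xpredT) //=.
have ltJ (J : {set 'I_m}) : (#|J| < m.+1)%N.
  by rewrite ltnS -[leqRHS]card_ord max_card.
apply: eq_bigr => t _.
rewrite mesymE raddf_sum /= mulr_sumr scaler_suml.
apply: eq_big => [J|J /eqP <-].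
  by rewrite -val_eqE /= inordK.
rewrite inordK //.
rewrite mevalX -big_mkcond /=.
rewrite (eq_bigr (fun i => (- y i) *: 'X)) => [|i _]; last by rewrite scaleNr.
rewrite scaler_prod prodr_const; congr (_ *: _).
rewrite prodrN; congr (_ * _).
rewrite big_mkcond; apply: eq_bigr => i _; rewrite mnmE.
by case: (i \in J).
Qed.

(** Truncating each geometric series at [N > d] loses no term of degree [d], and the exponent
    choices of total degree [d] are the monomials of the complete symmetric polynomial. *)
Lemma mhsym_eval (F : fieldType) (n N d : nat) (v : 'I_n -> F) : (d < N)%N ->
  (\prod_(i < n) \sum_(j < N) (v i ^+ j) *: 'X^j)`_d = (mhsym n F d).@[v].
Proof.
move=> dN; rewrite bigA_distr_bigA coef_sum /= raddf_sum /=.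
pose deg (f : {ffun 'I_n -> 'I_N}) := (\sum_i f i)%N.
pose mon (f : {ffun 'I_n -> 'I_N}) := [multinom (f i : nat) | i < n].
have monE f : mdeg (mon f) = deg f.
  by rewrite mdegE; apply: eq_bigr => i _; rewrite mnmE.
have cf (f : {ffun 'I_n -> 'I_N}) : (\prod_i (v i ^+ f i *: 'X^(f i)))`_d =
    if deg f == d then \prod_i v i ^+ f i else 0 :> F.
  rewrite scaler_prod prodrXr coefZ coefXn eq_sym -/(deg f).
  by case: eqP; rewrite ?mulr1 ?mulr0.
rewrite (eq_bigr _ (fun f _ => cf f)) -big_mkcond /=.
case: N dN @deg @mon monE {cf} => // N dN deg mon monE.
(* The default [bm0] is taken only for degrees above [d], outside the range of the sum. *)
pose h (f : {ffun 'I_n -> 'I_N.+1}) : 'X_{1..n < d.+1} := insubd bm0 (mon f).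
pose h' (m : 'X_{1..n < d.+1}) : {ffun 'I_n -> 'I_N.+1} := [ffun i => inord (m i)].
have h'E (m : 'X_{1..n < d.+1}) i : h' m i = m i :> nat.
  rewrite ffunE inordK // ltnS; apply: (@leq_trans (mdeg m)).
    by rewrite mdegE (bigD1 i) //= leq_addr.
  by rewrite -ltnS (leq_trans (bmdeg m)).
have monh' m : mon (h' m) = m by apply/mnmP=> i; rewrite mnmE h'E.
rewrite (reindex_onto h' h) /= => [|f /eqP fd].
  apply: eq_big => [m|m _]; last first.
    by rewrite mevalX; apply: eq_bigr => i _; rewrite h'E.
  rewrite -monE monh' /h monh' valKd eqxx andbT //.
apply/ffunP=> i; apply: val_inj; rewrite /= h'E /h insubdK ?mnmE //.
by rewrite unfold_in monE fd.
Qed.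

(* With E = prod (1 - v_i X), the truncated generating series B of the left-hand
   side in k satisfies E * B = Q mod X^N, and H = 1 / E mod X^N generates the h_j;
   Q is found by evaluating it at the 1 / v_i. *)
Lemma geometric_residue_sum (F : fieldType) (n m k : nat)
    (v : 'I_n -> F) (y : 'I_m -> F) :
  injective v -> (forall i, v i != 0) -> (m < n)%N ->
  \sum_i v i ^+ k *
     (\prod_(j | j != i) (v j - v i)^-1 * \prod_d (y d - v i)) =
  (-1) ^+ (n - m - 1) *
  \sum_(0 <= t < m.+1) (-1) ^+ t * (mesym m F t).@[y] *
     (mhsym n F (k.+1%:Z - t%:Z - (n - m)%N%:Z)).@[v].
Proof.
move=> vI v0 ltmn; set N := k.+1.
pose W i := \prod_(j | j != i) (v j - v i)^-1 * \prod_d (y d - v i).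
pose geo i : {poly F} := \sum_(l < N) v i ^+ l *: 'X^l.
pose E := \prod_i (1 - v i *: 'X).
pose B := \sum_i W i *: geo i.
pose H := \prod_i geo i.
pose Q := \sum_i W i *: \prod_(j | j != i) (1 - v j *: 'X).
have geoE i : (1 - v i *: 'X) * geo i = 1 - v i ^+ N *: 'X^N.
  rewrite -exprZn -[X in X - _ ^+ _](expr1n _ N) subrXX; congr (_ * _).
  by apply: eq_bigr => l _; rewrite expr1n mul1r exprZn.
have [R2 EH] : exists r, E * H = 1 + 'X^N * r.
  rewrite /E /H -big_split /=.
  elim/big_ind: _ => [|p p' [r ->] [r' ->]|i _].
  - by exists 0; rewrite mulr0 addr0.
  - exists (r' + r * (1 + 'X^N * r')).
    by rewrite mulrDl mul1r [X in _ = 1 + X]mulrDr -addrA -mulrA.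
  - by exists (- (v i ^+ N)%:P); rewrite geoE mulrN mulrC mul_polyC.
have [R1 EB] : exists r, E * B = Q + 'X^N * r.
  exists (\sum_i - (v i ^+ N) *: (W i *: \prod_(j | j != i) (1 - v j *: 'X))).
  rewrite /B /Q mulr_sumr mulr_sumr -big_split /=; apply: eq_bigr => i _.
  rewrite /E (bigD1 i) //= -scalerAr mulrAC geoE mulrBl mul1r scalerBr.
  congr (_ + _); rewrite scaleNr mulrN -!scalerAl -!scalerAr; congr (- _).
  by rewrite !scalerA mulrC.
(* At [1 / v i] a factor [1 - a X] is [(v i - a) / v i]. Reversing the [n - 1] differences to the
   [v j] and the [m] differences to the [y d] leaves [(- 1 / v i) ^ (n - m - 1)], hence the sign and
   the power of ['X]. *)
have QE : Q = (-1) ^+ (n - m - 1) *: ('X^(n - m - 1) * \prod_d (1 - y d *: 'X)).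
  apply: (@poly_interp_inj _ 'I_n setT (fun i => (v i)^-1)).
  - by move=> i j _ _ /invr_inj/vI.
  - apply: leq_trans (size_sum _ _ _) _; apply/bigmax_leqP => i _.
    apply: leq_trans (size_scale_leq _ _) _.
    have := @size_prod_affine F _ [set~ i] (fun=> 1) (fun j => - v j).
    rewrite cardsC1 cardsT card_ord prednK; last by apply: leq_ltn_trans ltmn.
    apply: leq_trans; rewrite eq_leq //; congr (size (polyseq _)).
    by apply: eq_big => [j|j _]; rewrite ?inE // scaleNr.
  - apply: leq_trans (size_scale_leq _ _) _.
    have sD : (size (\prod_d (1 - y d *: 'X))%R <= m.+1)%N.
      have := @size_prod_affine F _ [set: 'I_m] (fun=> 1) (fun j => - y j).
      rewrite cardsT card_ord; apply: leq_trans.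
      rewrite eq_leq //; congr (size (polyseq _)).
      by apply: eq_big => [j|j _]; rewrite ?inE // scaleNr.
    apply: leq_trans (size_polyMleq _ _) _; rewrite size_polyXn cardsT card_ord.
    rewrite addSn /=; apply: leq_trans (leq_add (leqnn _) sD) _.
    by rewrite addnS -subnDA addn1 -addSn -subSn // addnC subSS subnKC // ltnW.
  move=> i _.
  have ev (a : F) : (1 - a *: 'X).[(v i)^-1] = (v i)^-1 * (v i - a).
    by rewrite !hornerE mulrBr mulVf // mulrC.
  rewrite horner_sum (bigD1 i) //= [X in _ + X]big1 => [|j ji].
    rewrite addr0 !hornerZ hornerM hornerXn !horner_prod /W.
    rewrite (eq_bigr _ (fun j _ => ev (v j))) (eq_bigr _ (fun j _ => ev (y j))).
    have -> : \prod_d ((v i)^-1 * (v i - y d)) =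
        (- (v i)^-1) ^+ m * \prod_d (y d - v i).
      rewrite -[X in _ ^+ X]card_ord -prodr_const -big_split /=.
      by apply: eq_bigr => d _; rewrite mulNr -mulrN opprB.
    rewrite mulrAC -big_split /= (eq_bigr (fun=> - (v i)^-1)) => [|j ji].
      rewrite prodr_const cardC1 card_ord.
      rewrite mulrA -exprMn mulN1r mulrA -exprD.
      by rewrite subnAC subn1 subnK // -ltnS prednK // (leq_ltn_trans _ ltmn).
    rewrite -[v i - v j]opprB !mulrN mulrCA mulVf ?mulr1 // subr_eq0 eq_sym.
    by apply: contra ji => /eqP/vI->.
  rewrite hornerZ horner_prod [X in _ * X](bigD1 i) 1?eq_sym //=.
  by rewrite ev subrr mulr0 mul0r mulr0.
(* Expanding [E * H * B] in two ways eliminates [E] without inverting it. *)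
have BE : B = Q * H + 'X^N * (R1 * H - B * R2).
  have : (1 + 'X^N * R2) * B = (Q + 'X^N * R1) * H by rewrite -EH -EB mulrAC.
  rewrite mulrDl mul1r mulrDl => /(canRL (addrK _)) {1}->.
  by rewrite mulrBr addrA -!mulrA [R2 * B]mulrC.
have := congr1 (fun p : {poly F} => p`_k) BE.
rewrite coefD coefXnM ltnSn addr0 /B coef_sum => e.
transitivity (\sum_i (W i *: geo i)`_k).
  apply: eq_bigr => i _; rewrite coefZ mulrC; congr (_ * _).
  rewrite coef_sum (bigD1 ord_max) //= coefZ coefXn eqxx mulr1 big1 ?addr0 //.
  by move=> l; rewrite eq_sym -val_eqE /= coefZ coefXn => /negbTE->; rewrite mulr0.
rewrite e QE -scalerAl coefZ -mulrA coefXnM mesym_eval; congr (_ * _).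
(* The index of the complete symmetric function is [k - (n - m - 1) - t]; where it is negative, the
   power of ['X] exceeds [k] and the matching coefficient is 0 too. *)
have neg (j : int) : (j < 0)%R -> (mhsym n F j).@[v] = 0.
  by case: j => // j _; rewrite /= meval0.
rewrite big_mkord; case: ltnP => kc.
  by rewrite big1 // => t _; rewrite neg ?mulr0 //; lia.
rewrite poly_def mulr_suml coef_sum; apply: eq_bigr => t _.
rewrite -scalerAl coefZ coefXnM; congr (_ * _); case: ltnP => tk.
  by rewrite neg //; lia.
rewrite (_ : N%:Z - _ - _ = Posz (k - (n - m - 1) - t)) /N; last by lia.
by rewrite -(@mhsym_eval F n k.+1) // ltnS -subnDA leq_subr.
Qed.

(** * Boxes, neighbours and upsets of a skew shape *)

Local Open Scope nat_scope.

Lemma nth_partition_geq (p : seq nat) (i j : nat) :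
  is_partition p -> i <= j -> nth 0 p j <= nth 0 p i.
Proof.
case/andP=> sp _ ij; have [sj|js] := leqP (size p) j; first by rewrite nth_default.
have tr : transitive geq by move=> b a c /= ab bc; apply: leq_trans bc ab.
by apply: (sorted_leq_nth tr leqnn 0 sp); rewrite ?inE // (leq_ltn_trans ij).
Qed.

(** Turns a count of left, upper or northwest neighbours into a boolean, since a box has at most one
    of each. *)
Lemma card_exists (T : finType) (S : {set T}) (P : pred T) :
  (forall a b, P a -> P b -> a = b) ->
  #|[set a in S | P a]| = [exists a in S, P a].
Proof.
move=> P1; have [/exists_inP[a aS Pa]|/exists_inPn N] := boolP [exists a in S, P a].
  rewrite (_ : [set b in S | P b] = [set a]) ?cards1 //.
  apply/setP=> b; rewrite !inE; apply/andP/eqP=> [[_ Pb]|->] //; exact: P1.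
rewrite (_ : [set a in S | P a] = set0) ?cards0 //.
by apply/setP=> b; rewrite !inE; apply/andP=> -[/N/negP].
Qed.

Lemma card_setI_sum (T : finType) (S : {set T}) (P : pred T) :
  #|[set b in S | P b]| = \sum_(b in S) P b.
Proof. by rewrite -sum1dep_card big_mkcondr; apply: eq_bigr => b _; case: (P b). Qed.

Lemma sum_card_exchange (T : finType) (S : {set T}) (e : rel T) :
  \sum_(b in S) #|[set a in S | e a b]| = \sum_(a in S) #|[set b in S | e a b]|.
Proof.
under eq_bigr do rewrite card_setI_sum.
under [RHS]eq_bigr do rewrite card_setI_sum.
exact: exchange_big.
Qed.

Section Geometry.
Variables (r : nat) (lam : rshape r).
Local Notation T := (box lam).
Implicit Types (a b c d : T) (S : {set T}).

Definition weakly_nw c b : bool :=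
  [&& comp_of c == comp_of b, row_of c <= row_of b & col_of c <= col_of b].

Definition precedes c b : bool :=
  (comp_of c == comp_of b) &&
  ((row_of c == row_of b) && (col_of c < col_of b)
   || (col_of c == col_of b) && (row_of c < row_of b)).

(** The order filters left over when the smallest entries of a tableau are removed one by one. *)
Definition upset S : Prop := forall c b, c \in S -> weakly_nw c b -> b \in S.

Definition adj : rel T := fun a b => directly_left a b || directly_above a b.

Definition has_left S b := [exists a in S, directly_left a b].
Definition has_above S b := [exists a in S, directly_above a b].
Definition has_right S a := [exists b in S, directly_left a b].

Definition npred S b := #|[set a in S | adj a b]|.
Definition nnw S b := #|[set a in S | directly_northwest a b]|.

(** With neighbours counted inside [S], [minimal] and [dull] play the roles of sharp and dull
    corners; for the whole shape they are [SC] and [DC]. *)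
Definition minimal S := [set b in S | npred S b == 0].
Definition dull S := [set b in S | (npred S b == 2) && (nnw S b == 0)].

Lemma box_ext a b : comp_of a = comp_of b -> row_of a = row_of b ->
  col_of a = col_of b -> a = b.
Proof.
case: a b => [[k [i j]] p] [[k' [i' j']] p'].
by rewrite /comp_of /row_of /col_of /= => ? ? ?; subst; apply: val_inj.
Qed.

(** Convexity of skew shapes: both partitions decrease weakly, so moving down from [c] relaxes the
    inner bound and moving up from [b] relaxes the outer one. *)
Lemma box_between c b i j : comp_of c = comp_of b ->
  row_of c <= i <= row_of b -> col_of c <= j <= col_of b ->
  exists d, [/\ comp_of d = comp_of b, row_of d = i & col_of d = j].
Proof.
move=> e /andP[ci ib] /andP[cj jb].
have /andP[c1 _] : in_shape lam (val c) by rewrite -mem_cells ssvalP.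
have /andP[_ b2] : in_shape lam (val b) by rewrite -mem_cells ssvalP.
have md : (comp_of b, (i, j)) \in cells lam.
  rewrite mem_cells /in_shape /=; apply/andP; split.
    apply: leq_trans cj; apply: leq_trans c1; rewrite -/(comp_of c) e.
    exact: nth_partition_geq (inner_partition _ _) ci.
  apply: leq_ltn_trans jb _; apply: leq_trans b2 _.
  exact: nth_partition_geq (outer_partition _ _) ib.
by exists (SeqSub md).
Qed.

Lemma left_funl a a' b : directly_left a b -> directly_left a' b -> a = a'.
Proof.
move=> /and3P[/eqP ? /eqP ? /eqP ?] /and3P[/eqP ? /eqP ? /eqP ?].
by apply: box_ext; [congruence|lia|lia].
Qed.

Lemma left_funr a b b' : directly_left a b -> directly_left a b' -> b = b'.
Proof.
move=> /and3P[/eqP ? /eqP ? /eqP ?] /and3P[/eqP ? /eqP ? /eqP ?].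
by apply: box_ext; [congruence|lia|lia].
Qed.

Lemma above_funl a a' b : directly_above a b -> directly_above a' b -> a = a'.
Proof.
move=> /and3P[/eqP ? /eqP ? /eqP ?] /and3P[/eqP ? /eqP ? /eqP ?].
by apply: box_ext; [congruence|lia|lia].
Qed.

Lemma northwest_funl a a' b :
  directly_northwest a b -> directly_northwest a' b -> a = a'.
Proof.
move=> /and3P[/eqP ? /eqP ? /eqP ?] /and3P[/eqP ? /eqP ? /eqP ?].
by apply: box_ext; [congruence|lia|lia].
Qed.

Lemma nnwE S b : nnw S b = [exists a in S, directly_northwest a b].
Proof. by apply: card_exists => a a'; apply: northwest_funl. Qed.

Lemma npredE S b : npred S b = has_left S b + has_above S b.
Proof.
rewrite /has_left /has_above -!card_exists; first last.
- by move=> a a'; apply: left_funl.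
- by move=> a a'; apply: above_funl.
have E0 : [set a in S | directly_left a b] :&: [set a in S | directly_above a b] = set0.
  apply/setP=> a; rewrite !inE; apply/negP.
  by case/andP=> /andP[_ /and3P[_ /eqP ? /eqP ?]] /andP[_ /and3P[_ /eqP ? /eqP ?]]; lia.
rewrite -cardsUI E0 cards0 addn0.
by apply: eq_card => a; rewrite !inE -andb_orr.
Qed.

Lemma adj_not_northwest a b : adj a b -> directly_northwest a b = false.
Proof.
move=> ab; apply/negP=> /and3P[_ /eqP ? /eqP ?].
by case/orP: ab => /and3P[_ /eqP ? /eqP ?]; lia.
Qed.

(** The box just left of [b] lies between [c] and [b], so convexity puts it in the shape and the
    filter property puts it in [S]. *)
Lemma has_left_strict S b c : upset S -> c \in S -> weakly_nw c b ->
  col_of c < col_of b -> has_left S b.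
Proof.
move=> uS cS /and3P[/eqP e rcb ccb] lt.
have [||d [dc dr dk]] := @box_between c b (row_of b) (col_of b).-1 e; try lia.
apply/exists_inP; exists d.
  by apply: uS cS _; rewrite /weakly_nw e dc eqxx; lia.
by rewrite /directly_left dc eqxx; lia.
Qed.

Lemma has_above_strict S b c : upset S -> c \in S -> weakly_nw c b ->
  row_of c < row_of b -> has_above S b.
Proof.
move=> uS cS /and3P[/eqP e rcb ccb] lt.
have [||d [dc dr dk]] := @box_between c b (row_of b).-1 (col_of b) e; try lia.
apply/exists_inP; exists d.
  by apply: uS cS _; rewrite /weakly_nw e dc eqxx; lia.
by rewrite /directly_above dc eqxx; lia.
Qed.

(** Minimality forbids only direct neighbours; a box of [S] farther northwest would force one of
    them by convexity. *)
Lemma minimal_weakly_nw S a c : upset S -> a \in minimal S -> c \in S ->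
  weakly_nw c a -> c = a.
Proof.
move=> uS; rewrite inE npredE => /andP[aS]; rewrite addn_eq0 !eqb0.
case/andP=> nl na cS ca; have := ca => /and3P[/eqP e rca cca].
apply: box_ext e _ _; apply/eqP; rewrite eqn_leq ?rca ?cca /= leqNgt.
  by apply: contra na => ?; apply: has_above_strict ca _.
by apply: contra nl => ?; apply: has_left_strict ca _.
Qed.

Lemma precedes_weakly_nw c b : precedes c b -> weakly_nw c b /\ c != b.
Proof.
case/andP=> /eqP e lt; split; first by rewrite /weakly_nw e eqxx; lia.
by apply/eqP=> ecb; rewrite ecb in lt; lia.
Qed.

Lemma minimalP S a : upset S ->
  reflect (a \in S /\ forall c, c \in S -> ~~ precedes c a) (a \in minimal S).
Proof.
move=> uS; apply: (iffP idP) => [am|[aS N]].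
  split=> [|c cS]; first by move: am; rewrite inE => /andP[].
  by apply/negP=> /precedes_weakly_nw[ca /negP]; apply; apply/eqP;
    apply: minimal_weakly_nw uS am cS ca.
rewrite inE aS /= npredE addn_eq0 !eqb0; apply/andP; split; apply/exists_inPn => c /N;
by apply: contra => /and3P[/eqP e ? ?]; rewrite /precedes e eqxx; lia.
Qed.

Lemma upset_rem S a : upset S -> a \in minimal S -> upset (S :\ a).
Proof.
move=> uS am c b; rewrite !inE => /andP[ca cS] cb.
rewrite (uS _ _ cS cb) andbT; apply: contra ca => /eqP eb; rewrite eb in cb.
by rewrite (minimal_weakly_nw uS am cS cb).
Qed.

Lemma npred_rem S a b : a \in S -> npred S b = adj a b + npred (S :\ a) b.
Proof.
move=> aS; rewrite /npred (cardsD1 a) !inE aS; congr (_ + _).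
by apply: eq_card => c; rewrite !inE andbA.
Qed.

Lemma nnw_rem S a b : a \in S ->
  nnw S b = directly_northwest a b + nnw (S :\ a) b.
Proof.
move=> aS; rewrite /nnw (cardsD1 a) !inE aS; congr (_ + _).
by apply: eq_card => c; rewrite !inE andbA.
Qed.

(** A northwest neighbour in [S] forces the left and upper ones, so the Moebius value at [b] is
    [2 - 1 - 1 = 0]. *)
Lemma nnw_npred S b : upset S -> nnw S b != 0 -> npred S b = 2 /\ nnw S b = 1.
Proof.
move=> uS; rewrite nnwE; case: exists_inP => // -[a aS nw] _; split=> //.
have /and3P[/eqP e /eqP ? /eqP ?] := nw.
have ab : weakly_nw a b by rewrite /weakly_nw e eqxx; lia.
by rewrite npredE (has_left_strict uS aS ab) 1?(has_above_strict uS aS ab); lia.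
Qed.

(** Each horizontal pair is charged to its left box instead of its right one. Every pair then points
    right or up, and in the absence of diagonal pairs a box is charged at most once. *)
Lemma sum_npred S :
  \sum_(b in S) npred S b = \sum_(b in S) (has_right S b + has_above S b).
Proof.
under eq_bigr do rewrite npredE; rewrite !big_split /=; congr (_ + _).
transitivity (\sum_(b in S) #|[set a in S | directly_left a b]|).
  apply: eq_bigr => b _; rewrite card_exists // => a a'; exact: left_funl.
rewrite sum_card_exchange; apply: eq_bigr => a _.
by rewrite card_exists // => b b'; apply: left_funr.
Qed.

Lemma right_above_northwest a b c :
  directly_left b c -> directly_above a b -> directly_northwest a c.
Proof.
move=> /and3P[/eqP e1 /eqP ? /eqP ?] /and3P[/eqP e2 /eqP ? /eqP ?].
by rewrite /directly_northwest e2 e1 eqxx; lia.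
Qed.

Lemma has_right_above_le1 S b : (forall c, c \in S -> nnw S c = 0) ->
  has_right S b + has_above S b <= 1.
Proof.
move=> N; rewrite /has_right /has_above.
case: exists_inP => [[c cS bc]|_]; last exact: leq_b1.
case: exists_inP => // -[a aS ab].
have := N _ cS; rewrite nnwE; case: exists_inP => // -[]; exists a => //.
exact: right_above_northwest bc ab.
Qed.

(* A box maximizing column minus row. *)
Lemma exists_terminal S : S != set0 ->
  exists2 m, m \in S & has_right S m + has_above S m = 0.
Proof.
case/set0Pn=> b0 b0S; pose M := \max_(b : T) row_of b.
have leM b : row_of b <= M by apply: (leq_bigmax b).
have [m mS mmax] := arg_maxnP (fun b => col_of b + (M - row_of b)) b0S.
exists m => //; apply/eqP; rewrite addn_eq0 !eqb0.
apply/andP; split; apply/exists_inPn => c cS;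
  apply/negP=> /and3P[_ /eqP ? /eqP ?]; have /= := mmax _ cS;
  have := leM c; have := leM m; lia.
Qed.

(** Holds box by box: the number of predecessors is 0, 1 or 2, the extremes being minimal and
    dull. *)
Lemma sum_npred_card S : (forall b, b \in S -> nnw S b = 0) ->
  \sum_(b in S) npred S b + #|minimal S| = #|S| + #|dull S|.
Proof.
move=> N; rewrite /minimal /dull !card_setI_sum -sum1_card -!big_split.
apply: eq_bigr => b bS; rewrite N // andbT.
by rewrite npredE; case: has_left; case: has_above.
Qed.

(** The terminal box contributes 0 and every other box at most 1, so there are fewer adjacent pairs
    than boxes. This supplies the degree bound of [partial_fractions]. *)
Lemma card_dull_minimal S : S != set0 ->
  (forall b, b \in S -> nnw S b = 0) -> #|dull S| < #|minimal S|.
Proof.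
move=> S0 N; have [m mS R0] := exists_terminal S0.
have : \sum_(b in S) npred S b < #|S|.
  rewrite sum_npred (big_setD1 m) //= R0 add0n (cardsD1 m) mS ltnS -sum1_card.
  by apply: leq_sum => b _; apply: has_right_above_le1.
by have := sum_npred_card N; lia.
Qed.

End Geometry.

(** * Contents and Greene's product *)

Local Open Scope ring_scope.

Section Contents.
Variables (R : realType) (r : nat).
Local Notation F := (ratfun R r).
Local Notation q := (qvar R r).

Lemma qvar_neq0 : q != 0.
Proof.
by rewrite tofrac_eq0 -msupp_eq0 msuppX.
Qed.

Lemma uvar_neq0 (k : 'I_r) : uvar R k != 0.
Proof. by rewrite tofrac_eq0 -msupp_eq0 msuppX. Qed.

Lemma qvar_expr_uvarE (k : 'I_r) (m : nat) :
  uvar R k * q ^+ m = tofrac ('X_[U_(lift ord0 k) + U_(ord0) *+ m]).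
Proof. by rewrite mpolyXD -mpolyXn rmorphM rmorphXn. Qed.

Lemma mpolyX_tofrac_inj (m1 m2 : 'X_{1..r.+1}) :
  tofrac ('X_[m1] : {mpoly R[i][r.+1]}) = tofrac 'X_[m2] -> m1 = m2.
Proof.
move/eqP; rewrite tofrac_eq => /eqP/(congr1 (mcoeff m1)).
by rewrite !mcoeffX eqxx; case: eqP => [->//|_ /eqP]; rewrite oner_eq0.
Qed.

Lemma content_inj (k l : 'I_r) (a b c d : nat) :
  uvar R k * q ^ (2 * (a%:Z - b%:Z)) = uvar R l * q ^ (2 * (c%:Z - d%:Z)) ->
  k = l /\ (a + d = c + b)%N.
Proof.
(* Multiplying by [q ^ (2 (b + d))] makes both exponents nonnegative, so that monomials can be
   compared. *)
move/(congr1 (fun y => y * q ^ (2 * (b + d)%N%:Z))).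
rewrite -!mulrA -!expfzDr ?qvar_neq0 //.
rewrite (_ : 2 * _ + _ = Posz (2 * (a + d))%N); last by lia.
rewrite (_ : 2 * (c%:Z - _) + _ = Posz (2 * (c + b))%N); last by lia.
rewrite -!exprnP !qvar_expr_uvarE => /mpolyX_tofrac_inj e; split.
  have /eqP := congr1 (fun m : 'X_{1..r.+1} => m (lift ord0 k)) e.
  rewrite !mnmDE !mulmnE !mnm1E eqxx (inj_eq lift_inj) eq_liftF !mul0n !addn0.
  by case: (eqVneq l k) => // ->.
have /eqP := congr1 (fun m : 'X_{1..r.+1} => m ord0) e.
rewrite !mnmDE !mulmnE !mnm1E eqxx !(eq_sym _ ord0) !eq_liftF !mul1n !add0n.
by lia.
Qed.

Lemma qvar_sub_inv_neq0 : q - q^-1 != 0.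
Proof.
apply/negP; rewrite subr_eq0 => /eqP e.
have : tofrac ('X_[U_(ord0) *+ 2] : {mpoly R[i][r.+1]}) = tofrac 'X_[0].
  rewrite -mpolyXn mpolyX0 tofracXn tofrac1 -[LHS]/(q ^+ 2).
  by rewrite expr2 {1}e mulVf ?qvar_neq0.
move/mpolyX_tofrac_inj/mnmP/(_ ord0).
by rewrite mulmnE mnm1E mnm0E eqxx.
Qed.

Variable lam : rshape r.
Local Notation T := (box lam).
Implicit Types (a b c d : T) (S : {set T}).

Lemma ct_neq0 b : ct R b != 0.
Proof. by rewrite mulf_neq0 ?uvar_neq0 ?expfz_neq0 ?qvar_neq0. Qed.

Lemma ct_eqE a b : ct R a = ct R b ->
  comp_of a = comp_of b /\ (col_of a + row_of b = col_of b + row_of a)%N.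
Proof. exact: content_inj. Qed.

Lemma ct_left a b : directly_left a b -> ct R b = ct R a * q ^+ 2.
Proof.
case/and3P=> /eqP ec /eqP er /eqP ecol; rewrite /ct ec -er -ecol -mulrA.
rewrite (exprnP q 2) -expfzDr ?qvar_neq0 //; congr (_ * q ^ _); lia.
Qed.

Lemma ct_above a b : directly_above a b -> ct R b = ct R a * q ^- 2.
Proof.
case/and3P=> /eqP ec /eqP er /eqP ecol; rewrite /ct ec -er -ecol -mulrA.
rewrite (exprnP q 2) invr_expz -expfzDr ?qvar_neq0 //; congr (_ * q ^ _); lia.
Qed.

Lemma ct_northwest a b : directly_northwest a b -> ct R b = ct R a.
Proof.
case/and3P=> /eqP ec /eqP er /eqP ecol; rewrite /ct ec -er -ecol.
congr (_ * q ^ _); lia.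
Qed.

Lemma ct_adj a b : adj a b -> ct R b != ct R a.
Proof.
by move=> ab; apply/eqP=> /ct_eqE[_ ?]; case/orP: ab => /and3P[_ /eqP ? /eqP ?]; lia.
Qed.

(** Boxes of equal content lie on one diagonal, where any two are comparable, whereas distinct
    minimal boxes are not. *)
Lemma ct_minimal_inj S : upset S -> {in minimal S &, injective (ct R (lam := lam))}.
Proof.
move=> uS a b am bm /ct_eqE[e1 e2].
have [aS bS] : a \in S /\ b \in S by move: am bm; rewrite !inE => /andP[-> _] /andP[-> _].
have [le|lt] := leqP (row_of a) (row_of b).
  apply: (minimal_weakly_nw uS bm aS); rewrite /weakly_nw e1 eqxx; lia.
apply/esym/(minimal_weakly_nw uS am bS); rewrite /weakly_nw e1 eqxx; lia.
Qed.

(** Keeps the recursion away from poles: once [a] is removed, [z] becomes its content. A box [b]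
    further down the diagonal of [a] has a left neighbour in [S :\ a], so it is not minimal
    there. *)
Lemma ct_minimal_rem S a b : upset S -> a \in minimal S -> b \in minimal (S :\ a) ->
  ct R b != ct R a.
Proof.
move=> uS am; rewrite inE npredE => /andP[]; rewrite !inE => /andP[ba bS].
rewrite addn_eq0 !eqb0 => /andP[nl _]; apply/eqP=> /ct_eqE[e1 e2].
have aS : a \in S by move: am; rewrite inE => /andP[].
have [lt|le] := ltnP (row_of a) (row_of b); last first.
  case/eqP: ba; apply: (minimal_weakly_nw uS am bS).
  by rewrite /weakly_nw e1 eqxx; lia.
case/exists_inP: nl.
have [||d [dc dr dk]] := @box_between _ _ a b (row_of b) (col_of b).-1 (esym e1); try lia.
exists d; last by rewrite /directly_left dc eqxx; lia.
rewrite !inE; apply/andP; split; first by apply/eqP=> da; rewrite da in dr; lia.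
by apply: (uS _ _ aS); rewrite /weakly_nw dc e1 eqxx; lia.
Qed.

(* The product over pairs in Greene's formula for S with a bottom element added;
   [mobius S b] is the value of the Moebius function between bottom and b. *)
Definition greene_coeff S : F :=
  \prod_(b in S) ((\prod_(a in S | adj a b) (ct R b - ct R a)^-1) *
                  \prod_(a in S | directly_northwest a b) (ct R b - ct R a)).

Definition mobius S b : int := (npred S b)%:Z - 1 - (nnw S b)%:Z.

Definition greene S (z : F) : F :=
  greene_coeff S * \prod_(b in S) (ct R b - z) ^ mobius S b.

Lemma mobiusE S b : upset S -> b \in S ->
  mobius S b = (b \in dull S)%:Z - (b \in minimal S)%:Z.
Proof.
move=> uS bS; rewrite /mobius !inE bS /=.
have [nw0|/(nnw_npred uS)[-> ->]//] := eqVneq (nnw S b) 0%N.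
by rewrite nw0 npredE; case: has_left; case: has_above.
Qed.

Lemma prod_mobius S (P : pred T) (g : T -> F) : upset S ->
  \prod_(b in S | P b) g b ^ mobius S b =
  \prod_(b in minimal S | P b) (g b)^-1 * \prod_(b in dull S | P b) g b.
Proof.
move=> uS; rewrite big_mkcondr [X in _ = X * _]big_mkcondr [X in _ = _ * X]big_mkcondr /=.
have sub (A : {set T}) (h : T -> F) : A \subset S ->
    \prod_(b in A) h b = \prod_(b in S) if b \in A then h b else 1.
  move=> AS; rewrite -big_mkcondr /=; apply: eq_bigl => b.
  by rewrite andb_idl //; apply: (subsetP AS).
rewrite (sub (minimal S)) ?(sub (dull S)); first last.
- by apply/subsetP=> b; rewrite inE => /andP[].
- by apply/subsetP=> b; rewrite inE => /andP[].
rewrite -big_split /=; apply: eq_bigr => b bS; case: (P b); last by rewrite !if_same mulr1.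
rewrite mobiusE // !inE bS /=.
by case: (npred S b) => [|[|[|n]]] //=; case: (nnw S b) => [|n'] //=; rewrite ?mulr1 ?mul1r.
Qed.

Lemma greene_coeff_eq0 S a b :
  a \in S -> b \in S -> directly_northwest a b -> greene_coeff S = 0.
Proof.
move=> aS bS ab; rewrite /greene_coeff (bigD1 b) //= [X in _ * X * _](bigD1 a) ?aS //=.
by rewrite (ct_northwest ab) subrr mul0r mulr0 mul0r.
Qed.

(** Removing [a] drops from the coefficient a factor [ct b - ct a], or its inverse, for each
    diagonal or adjacent box [b] after [a]; the change of the exponent [mobius] at [b] compensates
    for it. *)
Lemma greene_rem S a : upset S -> a \in minimal S ->
  greene (S :\ a) (ct R a) =
  greene_coeff S * \prod_(b in S :\ a) (ct R b - ct R a) ^ mobius S b.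
Proof.
move=> uS am; have aS : a \in S by move: am; rewrite inE => /andP[].
rewrite /greene /greene_coeff [X in _ = X * _](big_setD1 a) //=.
have no c : c \in S -> adj c a = false.
  move: am; rewrite inE aS cards_eq0 => /eqP/setP/(_ c).
  by rewrite !inE => + cS; rewrite cS.
have nonw c : c \in S -> directly_northwest c a = false.
  move=> cS; apply/negP=> nw; have /and3P[/eqP e /eqP ? /eqP ?] := nw.
  suff ca : c = a by rewrite ca in nw; case/and3P: nw => _ /eqP; lia.
  by apply: (minimal_weakly_nw uS am cS); rewrite /weakly_nw e eqxx; lia.
have D1 (P : pred T) (f : T -> F) : \prod_(c in S | P c) f c =
    (if P a then f a else 1) * \prod_(c in S :\ a | P c) f c.
  by rewrite big_mkcondr (big_setD1 a) //= -big_mkcondr.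
have -> : \prod_(c in S | adj c a) (ct R a - ct R c)^-1 = 1.
  by apply: big_pred0 => c; apply/negP=> /andP[/no->].
have -> : \prod_(c in S | directly_northwest c a) (ct R a - ct R c) = 1.
  by apply: big_pred0 => c; apply/negP=> /andP[/nonw->].
rewrite !mul1r -!big_split /=; apply: eq_bigr => b; rewrite !inE => /andP[ba bS].
have mobE := nnw_npred uS (b := b).
rewrite !D1 /mobius; rewrite (npred_rem b aS) (nnw_rem b aS) in mobE *.
set X := \prod_(c in S :\ a | adj c b) _.
set Y := \prod_(c in S :\ a | directly_northwest c b) _.
set y := ct R b - ct R a.
(* For a diagonal neighbour [y = 0], so exponents cannot be split; they are computed instead: 1
   without [a] and 0 with it. *)
have [nw|_] := boolP (directly_northwest a b).
  have na : adj a b = false by apply: contraTF nw => /adj_not_northwest->.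
  rewrite nw na /= in mobE *; have [//|e1 e2] := mobE.
  rewrite (_ : npred (S :\ a) b = 2%N) 1?(_ : nnw (S :\ a) b = 0%N); try lia.
  by rewrite !mul1r -!mulrA; congr (_ * _); rewrite mulrC mulr1.
have [ab|_] := boolP (adj a b); last by rewrite !mul1r.
have y0 : y != 0 by rewrite subr_eq0 ct_adj.
rewrite mul1r -!mulrA [RHS]mulrCA; congr (_ * _); rewrite [RHS]mulrCA; congr (_ * _).
rewrite (_ : (true + _)%N%:Z - 1 - _ = 1 + ((npred (S :\ a) b)%:Z - 1 - (nnw (S :\ a) b)%:Z)); last by lia.
by rewrite [y ^ (1 + _)]expfzDr // expr1z mulKf.
Qed.
End Contents.

(** * Linear extensions *)

Section LinearExtensions.
Variables (R : realType) (r : nat) (lam : rshape r).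
Local Notation F := (ratfun R r).
Local Notation T := (box lam).
Implicit Types (a b c d : T) (S : {set T}).

(** Words listing the boxes by increasing entry, defined by removing minimal boxes so as to match
    the induction in [greene_sum]. *)
Fixpoint linext S (s : seq T) : bool :=
  if s is a :: s' then (a \in minimal S) && linext (S :\ a) s' else S == set0.

(** Greene's summand; [z] is the content of the preceding box, or at the start the value at the
    added bottom element. *)
Fixpoint chain_weight (z : F) (s : seq T) : F :=
  if s is a :: s' then (ct R a - z)^-1 * chain_weight (ct R a) s' else 1.

Lemma big_tuple_cons n (P : pred (seq T)) (f : seq T -> F) :
  \sum_(t : n.+1.-tuple T | P t) f t =
  \sum_(a : T) \sum_(t : n.-tuple T | P (a :: t)) f (a :: t).
Proof.
rewrite pair_big_dep /=.
rewrite (reindex (fun p : T * n.-tuple T => [tuple of p.1 :: p.2])) //=.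
exists (fun t => (thead t, [tuple of behead t])) => [[a t] _|t _] /=.
  by congr (_, _); apply: val_inj.
by rewrite [RHS]tuple_eta; apply: val_inj.
Qed.

Lemma chain_weight_sum_step n S (z : F) :
  \sum_(t : n.+1.-tuple T | linext S t) chain_weight z t =
  \sum_(a in minimal S) (ct R a - z)^-1 *
     \sum_(t : n.-tuple T | linext (S :\ a) t) chain_weight (ct R a) t.
Proof.
rewrite (big_tuple_cons _ (linext S)) [RHS]big_mkcond; apply: eq_bigr => a _ /=.
case: (a \in minimal S) => /=; last by rewrite big_pred0.
by rewrite mulr_sumr.
Qed.

Lemma greene_rem_residue S a : upset S -> a \in minimal S ->
  greene (S :\ a) (ct R a) = greene_coeff R S *
    (\prod_(b in minimal S :\ a) (ct R b - ct R a)^-1 *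
     \prod_(d in dull S) (ct R d - ct R a)).
Proof.
move=> uS am; rewrite greene_rem //; congr (_ * _).
have sub (A : {set T}) : \prod_(b in A :\ a) (ct R b - ct R a) ^ mobius S b =
   \prod_(b in A | b != a) (ct R b - ct R a) ^ mobius S b.
  by apply: eq_bigl => b; rewrite !inE andbC.
rewrite sub (prod_mobius _ (fun b => ct R b - ct R a)) //; congr (_ * _).
  by apply: eq_bigl => b; rewrite in_setD1 andbC.
(* The box [a] has no predecessor, hence is not dull. *)
apply: eq_bigl => b; rewrite andb_idr // inE => /andP[_ /andP[bd _]].
by apply: contraTneq am => <-; rewrite !inE (eqP bd) andbF.
Qed.

Lemma greene_sum n S (z : F) : upset S -> #|S| = n ->
  {in minimal S, forall s, ct R s != z} ->
  \sum_(t : n.-tuple T | linext S t) chain_weight z t = greene S z.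
Proof.
elim: n S z => [|n IHn] S z uS cS zS.
  have S0 : S = set0 by apply/eqP; rewrite -cards_eq0 cS.
  rewrite /greene /greene_coeff S0 !big_set0 mulr1.
  rewrite (bigD1 [tuple]) ?eqxx //= big1 ?addr0 // => t /andP[_ /eqP[]].
  exact: tuple0.
rewrite chain_weight_sum_step.
under eq_bigr => a am.
  have aS : a \in S by move: am; rewrite inE => /andP[].
  rewrite IHn; first last.
  - by move=> b; apply: ct_minimal_rem.
  - by move: cS; rewrite (cardsD1 a) aS add1n => -[].
  - exact: upset_rem.
  rewrite greene_rem_residue // mulrCA; over.
rewrite -mulr_sumr /greene.
(* A vanishing coefficient kills both sides; otherwise there is no diagonal pair and the degree
   bound holds. *)
have [->|c0] := eqVneq (greene_coeff R S) 0; first by rewrite !mul0r.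
have S0 : S != set0 by rewrite -cards_eq0 cS.
have nw0 b : b \in S -> nnw S b = 0%N.
  move=> bS; apply/eqP; rewrite nnwE eqb0; apply: contraNN c0.
  by case/exists_inP=> a aS nw; rewrite (greene_coeff_eq0 _ aS bS nw).
rewrite partial_fractions ?card_dull_minimal //; last exact: ct_minimal_inj.
have := prod_mobius xpredT (fun b => ct R b - z) uS.
by rewrite !(eq_bigl _ _ (fun b => andbT _)) => ->.
Qed.

Lemma linextP S (s : seq T) : upset S ->
  reflect [/\ uniq s, s =i S &
     {in S &, forall b c, precedes b c -> (index b s < index c s)%N}] (linext S s).
Proof.
move=> uS; apply: (iffP idP).
  elim: s S uS => [|a s IHs] S uS /=; first by move/eqP=> ->; split=> // b; rewrite inE.
  case/andP=> am /(IHs _ (upset_rem uS am))[us sS os].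
  have [aS mina] := minimalP a uS am.
  split.
  - by rewrite us andbT sS !inE eqxx.
  - by move=> b; rewrite inE sS !inE; case: eqVneq => [->|].
  move=> b c bS cS bc /=; case: (eqVneq a c) => [ac|ac].
    by have := mina _ bS; rewrite ac bc.
  case: (eqVneq a b) => // ab; rewrite ltnS; apply: os => //;
  by rewrite !inE eq_sym ?ab ?ac.
elim: s S uS => [|a s IHs] S uS [us sS os] /=.
  by apply/eqP/setP=> b; rewrite -sS inE.
have aS : a \in S by rewrite -sS inE eqxx.
have am : a \in minimal S.
  apply/minimalP=> //; split=> // c cS; apply/negP=> ca.
  by have := os _ _ cS aS ca; rewrite /= eqxx.
move: us => /= /andP[nas us]; rewrite am; apply: IHs; first exact: upset_rem.
split=> // [b|b c].
  rewrite !inE -sS inE; case: (eqVneq b a) => // ->; exact/negbTE.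
rewrite !inE => /andP[ba bS] /andP[ca cS] bc; have := os _ _ bS cS bc.
by rewrite /= eq_sym (negbTE ba) eq_sym (negbTE ca).
Qed.

End LinearExtensions.

(** * Standard tableaux as linear extensions *)

Section TableauxAsLinearExtensions.
Variables (r : nat) (lam : rshape r) (n_gt0 : (0 < nboxes lam)%N) (b0 : box lam).
Local Notation T := (box lam).
Local Notation n := (nboxes lam).
Implicit Types (a b c d : T) (L : filling lam) (t : n.-tuple T).

(** The default is reached only when [b] is missing from [t]. *)
Definition filling_of t : filling lam :=
  [ffun b => odflt (Ordinal n_gt0) (insub (index b t))].

Definition reading_word L : n.-tuple T :=
  [tuple odflt b0 [pick b | L b == i] | i < n].

Lemma filling_ofE t b : b \in t -> filling_of t b = index b t :> nat.
Proof.
move=> bt; rewrite ffunE; have := bt; rewrite -index_mem size_tuple => lt.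
by rewrite (insubT (fun m => m < n)%N lt).
Qed.

Lemma tnth_reading_word L b : injective L -> tnth (reading_word L) (L b) = b.
Proof.
move=> LI; rewrite tnth_mktuple; case: pickP => [c /eqP/LI//|/(_ b)].
by rewrite eqxx.
Qed.

Lemma reading_wordP L : injective L ->
  uniq (reading_word L) /\ forall b, index b (reading_word L) = L b.
Proof.
move=> LI; have onto i : exists b, L b = i.
  have /codomP[b ->] : i \in codom L by apply: inj_card_onto; rewrite ?card_ord.
  by exists b.
have u : uniq (reading_word L).
  apply/tuple_uniqP => i j; have [b <-] := onto i; have [c <-] := onto j.
  by rewrite !tnth_reading_word // => ->.
split=> // b; rewrite -{1}(tnth_reading_word b LI) (tnth_nth b0) index_uniq //.
by rewrite size_tuple.
Qed.

Lemma filling_ofK L : injective L -> filling_of (reading_word L) = L.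
Proof.
move=> LI; have [u ix] := reading_wordP LI.
apply/ffunP=> b; apply: val_inj; rewrite /= filling_ofE ?ix //.
by rewrite -index_mem ix size_tuple.
Qed.

Lemma standardP L : reflect
  (injective L /\ forall b c, precedes b c -> (L b < L c)%N) (standard L).
Proof.
apply: (iffP and3P) => [[/injectiveP LI /forallP rows /forallP cols]|[LI incr]].
  split=> // b c /andP[cbc]; case/orP=> /andP[e lt].
    by have /forallP/(_ c)/implyP := rows b; apply; rewrite cbc e.
  by have /forallP/(_ c)/implyP := cols b; apply; rewrite cbc e.
split; first exact/injectiveP.
- apply/forallP=> b; apply/forallP=> c; apply/implyP=> /and3P[e1 e2 lt].
  by apply: incr; rewrite /precedes e1 e2 lt.
- apply/forallP=> b; apply/forallP=> c; apply/implyP=> /and3P[e1 e2 lt].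
  by apply: incr; rewrite /precedes e1 e2 lt orbT.
Qed.

Lemma upsetT : upset [set: T].
Proof. by move=> c b; rewrite !inE. Qed.

(** The left-hand side is the condition that [reindex_onto] creates when the sum over fillings
    becomes a sum over words. *)
Lemma linext_standard t :
  standard (filling_of t) && (reading_word (filling_of t) == t) =
  linext [set: T] t.
Proof.
apply/andP/(linextP _ upsetT) => [[/standardP[LI incr] /eqP e]|[u tT incr]].
  have [u ix] := reading_wordP LI; rewrite e in u ix; split=> // [b|b c _ _ bc].
    by rewrite -index_mem ix size_tuple inE ltn_ord.
  by rewrite !ix incr.
have fE b : filling_of t b = index b t :> nat by rewrite filling_ofE ?tT ?inE.
have LI : injective (filling_of t).
  move=> b c /(congr1 val) /=; rewrite !fE => e.
  by rewrite -(nth_index b0 (_ : b \in t)) ?e ?nth_index // tT inE.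
split; first by apply/standardP; split=> // b c bc; rewrite !fE incr ?inE.
apply/eqP/val_inj/(@eq_from_nth _ b0); rewrite ?size_tuple // => i ltin.
pose b := nth b0 t i; rewrite -/b.
have -> : i = filling_of t b by rewrite fE index_uniq ?size_tuple.
by rewrite -tnth_nth tnth_reading_word.
Qed.

Variable R : realType.
Local Notation F := (ratfun R r).
Local Notation q := (qvar R r).

(** Each factor [y / (1 - x / x')] equals [y * x' / (x' - x)], which separates the contents from the
    chain weight. *)
Lemma prod_step_chain_weight (y : F) a (s : seq T) :
  \prod_(0 <= i < size s)
     (y / (1 - ct R (nth b0 (a :: s) i) / ct R (nth b0 (a :: s) i.+1))) =
  y ^+ size s * (\prod_(b <- s) ct R b) * chain_weight (ct R a) s.
Proof.
elim: s a => [|b s IHs] a; first by rewrite big_nil big_geq // !mulr1.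
rewrite big_nat_recl // IHs big_cons /= exprS.
have -> : 1 - ct R a / ct R b = (ct R b - ct R a) / ct R b.
  by rewrite mulrBl divff ?ct_neq0.
rewrite invf_div; move: (ct R b) (ct R b - ct R a)^-1 (chain_weight _ _).
by move: (\prod_(_ <- _) _) (y ^+ _) => *; ring.
Qed.

Lemma Delta_tableau_chain k t a s : linext [set: T] t -> val t = a :: s ->
  Delta_tableau R k (filling_of t) =
  ct R a ^+ k *
   ((q - q^-1) ^+ size s * (\prod_(b <- s) ct R b) * chain_weight (ct R a) s).
Proof.
move=> /(linextP _ upsetT)[u tT _] ets.
have fE b : filling_of t b = index b t :> nat by rewrite filling_ofE ?tT ?inE.
have at_nth i : (i < n)%N -> ct_at R (filling_of t) i.+1 = ct R (nth b0 t i).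
  move=> ltin; rewrite /ct_at /box_at; case: pickP => [b|/(_ (nth b0 t i))].
    by rewrite eqSS fE => /eqP <- /=; rewrite nth_index // tT inE.
  by rewrite eqSS fE index_uniq ?eqxx ?size_tuple.
have en : n = (size s).+1 by rewrite -(size_tuple t) ets.
rewrite /Delta_tableau at_nth ?en // ets /=; congr (_ * _).
rewrite -prod_step_chain_weight -ets.
rewrite big_add1 big_add1 /=.
rewrite (_ : n.-1 = size s) ?en //.
rewrite big_nat [RHS]big_nat; apply: eq_bigr => i /andP[_ lti].
by rewrite /T_diag /= !at_nth ?en // ltnS ltnW.
Qed.

End TableauxAsLinearExtensions.

Section DeltaResidues.
Variables (R : realType) (r : nat) (lam : rshape r).
Local Notation T := (box lam).
Local Notation q := (qvar R r).

(** The first box [a] is split off, and by Greene's formula the rest of the word sums to the residue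
    at its content. The quotient by [ct R a] corrects for the first box, whose content is in the
    full product but comes from no [T_diag] factor. *)
Lemma Delta_residues k : (0 < nboxes lam)%N ->
  Delta R lam k =
  (q - q^-1) ^+ (nboxes lam - 1) * (\prod_(b : T) ct R b) * greene_coeff R [set: T] *
  \sum_(a in minimal [set: T]) ct R a ^+ k / ct R a *
    (\prod_(b in minimal [set: T] :\ a) (ct R b - ct R a)^-1 *
     \prod_(d in dull [set: T]) (ct R d - ct R a)).
Proof.
move=> n0; have [b0 _] : exists b0 : T, true.
  by case/card_gt0P: (n0) => b0; exists b0.
pose f (s : seq T) : ratfun R r := if s is a :: s' then
   ct R a ^+ k * ((q - q^-1) ^+ size s' * (\prod_(b <- s') ct R b) *
     chain_weight (ct R a) s') else 0.
have -> : Delta R lam k =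
    \sum_(t : (nboxes lam).-tuple T | linext [set: T] t) f t.
  rewrite /Delta (reindex_onto (filling_of n0) (reading_word b0)) => [|L /standardP[LI _]].
    apply: eq_big => [t|t]; rewrite linext_standard // => lt.
    case E : (tval t) => [|a s]; last by rewrite (Delta_tableau_chain n0 b0 _ _ lt E).
    by have := size_tuple t; rewrite E => e; have := n0; rewrite -[X in (0 < X)%N]e.
  exact: filling_ofK.
case en : (nboxes lam) n0 => [//|n] _.
have uT := @upsetT _ lam.
rewrite big_tuple_cons subn1 /= [in RHS]mulr_sumr [in RHS]big_mkcond.
apply: eq_bigr => a _; case: ifP => am; last by rewrite big_pred0.
have step : \sum_(t : n.-tuple T | linext ([set: T] :\ a) t) chain_weight (ct R a) t
    = greene ([set: T] :\ a) (ct R a).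
  apply: greene_sum; [exact: upset_rem| | by move=> b; apply: ct_minimal_rem].
  by move: en; rewrite /nboxes -cardsT (cardsD1 a) inE => -[].
transitivity (\sum_(t : n.-tuple T | linext ([set: T] :\ a) t)
   (q - q^-1) ^+ n * (\prod_(b : T) ct R b) * (ct R a ^+ k / ct R a) *
   chain_weight (ct R a) t).
  apply: eq_bigr => t /(linextP _ (upset_rem uT am))[u tT _].
  have -> : \prod_(b : T) ct R b = ct R a * \prod_(b <- t) ct R b.
    rewrite (bigD1 a) //= big_uniq //=; congr (_ * _); apply: eq_bigl => b.
    by rewrite tT !inE andbT.
  rewrite size_tuple; move: (chain_weight _ _) (\prod_(_ <- _) _) (_ ^+ n) (_ ^+ k).
  by move: (ct R a) (ct_neq0 R a) => x x0 w p y z; rewrite -{1}(divfK x0 z); ring.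
rewrite -mulr_sumr step greene_rem_residue //.
by rewrite -!mulrA; congr (_ * (_ * _)); rewrite !mulrA [_ * greene_coeff _ _]mulrC !mulrA.
Qed.

End DeltaResidues.

(** * Connected components *)

Local Open Scope nat_scope.

Lemma card_fibers (T : finType) (C : {set T}) (f : T -> nat) (P : pred T) :
  {in C &, forall a b, P a -> P b -> f a = f b -> a = b} ->
  {in C, forall b, exists a, [/\ a \in C, P a & f a = f b]} ->
  #|[set b in C | P b]| = size (undup [seq f b | b in C]).
Proof.
move=> fI ex; rewrite cardE -(size_map f); apply: perm_size; apply: uniq_perm.
- rewrite map_inj_in_uniq ?enum_uniq // => a b.
  by rewrite !mem_enum !inE => /andP[aC Pa] /andP[bC Pb]; apply: fI.
- exact: undup_uniq.
move=> m; rewrite mem_undup; apply/mapP/imageP => [[b bA ->]|[b bC ->]].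
  by exists b => //; move: bA; rewrite mem_enum inE => /andP[].
by have [a [aC Pa fa]] := ex b bC; exists a; rewrite ?mem_enum ?inE ?aC.
Qed.

Section Components.
Variables (r : nat) (lam : rshape r).
Local Notation T := (box lam).
Implicit Types (a b c d : T) (C : {set T}).

(** By convexity a diagonal pair forces the other two boxes of its block, so [nnw] detects
    blocks. *)
Lemma has_2x2_blockE :
  has_2x2_block lam = [exists a, exists d, directly_northwest (lam := lam) a d].
Proof.
apply/existsP/existsP=> [[a /existsP[b /existsP[c /existsP[d]]]]|[a /existsP[d nw]]].
  case/and4P=> ab ac bd cd; exists a; apply/existsP; exists d.
  move: ab bd => /and3P[/eqP e1 /eqP ? /eqP ?] /and3P[/eqP e2 /eqP ? /eqP ?].
  by rewrite /directly_northwest e1 e2 eqxx; lia.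
have : nnw [set: T] d != 0%N.
  by rewrite nnwE eqb0 negbK; apply/existsP; exists a; rewrite inE.
case/(nnw_npred (@upsetT _ lam)); rewrite npredE => p2 _.
have /andP[/exists_inP[c _ cd] /exists_inP[b _ bd]] :
    has_left [set: T] d && has_above [set: T] d.
  by move: p2; case: has_left; case: has_above.
exists a; apply/existsP; exists b; apply/existsP; exists c; apply/existsP; exists d.
rewrite cd bd !andbT.
move: nw cd bd => /and3P[/eqP e1 /eqP ? /eqP ?] /and3P[/eqP e2 /eqP ? /eqP ?]
  /and3P[/eqP e3 /eqP ? /eqP ?].
by rewrite /directly_left /directly_above e1 e2 e3 eqxx /=; lia.
Qed.

Lemma share_edge_sym a b : share_edge a b = share_edge b a.
Proof.
by rewrite /share_edge; do !case: (directly_above _ _); do !case: (directly_left _ _).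
Qed.

Lemma CC_partition : partition (CC lam) [set: T].
Proof.
apply: equivalence_partitionP => a b c _ _ _; split; first exact: connect0.
move=> ab; apply/idP/idP; last exact: connect_trans.
by apply: connect_trans; rewrite (sym_connect_sym share_edge_sym).
Qed.

Lemma CC_connect C b c : C \in CC lam -> b \in C ->
  (c \in C) = connect (share_edge (lam := lam)) b c.
Proof.
case/imsetP=> a _ ->; rewrite !inE => ab.
have eq := same_connect (sym_connect_sym share_edge_sym) ab.
exact: eq.
Qed.

Lemma CC_adj C a b : C \in CC lam -> b \in C -> adj a b -> a \in C.
Proof.
move=> compC bC ab; rewrite (CC_connect _ compC bC) connect1 //.
by case/orP: ab => h; rewrite /share_edge h !orbT.
Qed.

Lemma CC_comp C b c : C \in CC lam -> b \in C -> c \in C -> comp_of b = comp_of c.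
Proof.
move=> compC bC; rewrite (CC_connect _ compC bC) => bc.
have cl : closed (share_edge (lam := lam)) [pred a | comp_of a == comp_of b].
  apply: intro_closed; first exact: sym_connect_sym share_edge_sym.
  by move=> x y; rewrite !inE => /or4P[] /and3P[/eqP e _ _] /eqP <-; rewrite e.
have := closed_connect cl bc; rewrite !inE eqxx.
by move/esym/eqP.
Qed.

(** Rows of a skew shape have no gaps, so a box without left neighbour is the first of its row. Each
    row of [C] contains one, because stepping left never leaves the component. *)
Lemma card_no_left C : C \in CC lam ->
  #|[set b in C | ~~ has_left [set: T] b]| = nrows C.
Proof.
move=> compC; have uT := @upsetT _ lam; apply: card_fibers.
  have key a b : a \in C -> b \in C -> ~~ has_left [set: T] b ->
      row_of a = row_of b -> (col_of b <= col_of a)%N.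
    move=> aC bC nb e; rewrite leqNgt; apply: contra nb => lt.
    apply: (has_left_strict uT (in_setT a)) => //.
    by rewrite /weakly_nw (CC_comp compC aC bC) eqxx; lia.
  move=> a b aC bC na nb e; apply: (box_ext (CC_comp compC aC bC) e).
  by apply/eqP; rewrite eqn_leq !key.
move=> b; have [m] := ubnP (col_of b); elim: m b => // m IH b lt bC.
have [/exists_inP[c _ cb]|nb] := boolP (has_left [set: T] b); last by exists b.
have cC : c \in C by apply: (CC_adj compC bC); rewrite /adj cb.
have /and3P[_ /eqP e /eqP ?] := cb.
have [|a [aC na ea]] := IH c _ cC; first by lia.
by exists a; rewrite ea.
Qed.

Lemma card_no_above C : C \in CC lam ->
  #|[set b in C | ~~ has_above [set: T] b]| = ncols C.
Proof.
move=> compC; have uT := @upsetT _ lam; apply: card_fibers.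
  have key a b : a \in C -> b \in C -> ~~ has_above [set: T] b ->
      col_of a = col_of b -> (row_of b <= row_of a)%N.
    move=> aC bC nb e; rewrite leqNgt; apply: contra nb => lt.
    apply: (has_above_strict uT (in_setT a)) => //.
    by rewrite /weakly_nw (CC_comp compC aC bC) eqxx; lia.
  move=> a b aC bC na nb e; apply: (fun h => box_ext (CC_comp compC aC bC) h e).
  by apply/eqP; rewrite eqn_leq !key.
move=> b; have [m] := ubnP (row_of b); elim: m b => // m IH b lt bC.
have [/exists_inP[c _ cb]|nb] := boolP (has_above [set: T] b); last by exists b.
have cC : c \in C by apply: (CC_adj compC bC); rewrite /adj cb orbT.
have /and3P[_ /eqP ? /eqP e] := cb.
have [|a [aC na ea]] := IH c _ cC; first by lia.
by exists a; rewrite ea.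
Qed.

(** Orients a border strip from its bottom left end to its top right end. Without diagonal pairs no
    box has two such steps, as its right and upper neighbours would form one. *)
Definition northeast_step b c := directly_left b c || directly_above c b.

Lemma share_edgeE b c :
  share_edge b c = northeast_step b c || northeast_step c b.
Proof.
rewrite /share_edge /northeast_step.
by do !case: (directly_above _ _); do !case: (directly_left _ _).
Qed.

Hypothesis no_nw : forall b, nnw [set: T] b = 0%N.

Lemma northwest_absurd a b : ~~ directly_northwest (lam := lam) a b.
Proof.
have /eqP := no_nw b; rewrite nnwE eqb0; apply: contra => ab.
by apply/existsP; exists a; rewrite inE.
Qed.

Lemma northeast_step_fun b c c' :
  northeast_step b c -> northeast_step b c' -> c = c'.
Proof.
move=> /orP[bc|bc] /orP[bc'|bc'].
- exact: left_funr bc bc'.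
- by have := right_above_northwest bc bc'; rewrite (negbTE (northwest_absurd _ _)).
- by have := right_above_northwest bc' bc; rewrite (negbTE (northwest_absurd _ _)).
- exact: above_funl bc bc'.
Qed.

Lemma terminal_northeast C b c : C \in CC lam -> b \in C ->
  has_right C b + has_above C b = 0 -> ~~ northeast_step b c.
Proof.
move=> compC bC /eqP; rewrite addn_eq0 !eqb0 => /andP[nr na].
apply/negP=> bc; have cC : c \in C.
  by rewrite (CC_connect _ compC bC) connect1 // share_edgeE bc.
case/orP: bc => bc; [case/exists_inP: nr | case/exists_inP: na]; by exists c.
Qed.

(** The boxes from which steps lead to [t] are closed under sharing an edge, since steps are unique.
    They thus include [t'], from which no step leaves. *)
Lemma terminal_unique C t t' : C \in CC lam -> t \in C -> t' \in C ->
  has_right C t + has_above C t = 0 -> has_right C t' + has_above C t' = 0 ->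
  t = t'.
Proof.
move=> compC tC t'C; move/(terminal_northeast _ compC tC)=> tT.
move/(terminal_northeast _ compC t'C)=> tT'.
have cl : closed (share_edge (lam := lam)) [pred b | connect northeast_step b t].
  apply: intro_closed; first exact: sym_connect_sym share_edge_sym.
  move=> x y; rewrite !inE share_edgeE => /orP[xy|yx] xt; last first.
    exact: connect_trans (connect1 yx) xt.
  case/connectP: xt => [[|z p]] /=; first by move=> _ e; rewrite -e (negbTE (tT _)) in xy.
  case/andP=> xz zp ->; rewrite (northeast_step_fun xy xz).
  by apply/connectP; exists p.
have := closed_connect cl (_ : connect (share_edge (lam := lam)) t t').
rewrite -(CC_connect _ compC tC) => /(_ t'C); rewrite !inE connect0 => /esym/connectP[[|z p]] //=.
by case/andP; rewrite (negbTE (tT' _)).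
Qed.

(** Every box but the unique terminal one has exactly one northeast step, and these steps are the
    adjacent pairs. *)
Lemma sum_npred_CC C : C \in CC lam ->
  (\sum_(b in C) npred [set: T] b).+1 = #|C|.
Proof.
move=> compC; have nwC b : b \in C -> nnw C b = 0%N.
  move=> bC; apply/eqP; rewrite nnwE eqb0; apply/exists_inPn=> a _.
  exact: northwest_absurd.
have -> : \sum_(b in C) npred [set: T] b = \sum_(b in C) npred C b.
  apply: eq_bigr => b bC; apply: eq_card => a; rewrite !inE.
  by case ab: (adj a b); rewrite ?andbF // (CC_adj compC bC ab).
have C0 : C != set0.
  by apply: contraTneq compC => ->; have /and3P[] := CC_partition.
have [m mC R0] := exists_terminal C0.
rewrite sum_npred (big_setD1 m) //= R0 add0n (cardsD1 m) mC add1n; congr _.+1.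
rewrite -sum1_card; apply: eq_bigr => b; rewrite !inE => /andP[bm bC].
apply/eqP; rewrite eqn_leq has_right_above_le1 // lt0n.
by apply: contra bm => /eqP b0; rewrite (terminal_unique compC bC mC b0 R0).
Qed.

(** In a component of [m] boxes, [m - nrows] have a left neighbour and [m - ncols] an upper one; the
    total [m - 1] gives [m = nrows + ncols - 1]. *)
Lemma sum_left_above_CC C : C \in CC lam ->
  \sum_(b in C) has_left [set: T] b = (ncols C - 1)%N /\
  \sum_(b in C) has_above [set: T] b = (nrows C - 1)%N.
Proof.
move=> compC; have := sum_npred_CC compC.
under eq_bigr do rewrite npredE; rewrite big_split /=.
have compl (P : pred T) : (\sum_(b in C) P b + #|[set b in C | ~~ P b]| = #|C|)%N.
  rewrite card_setI_sum -big_split -sum1_card; apply: eq_bigr => b _.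
  by case: (P b).
have := compl (has_left [set: T]); rewrite card_no_left //.
have := compl (has_above [set: T]); rewrite card_no_above //.
move: (\sum_(b in C) has_left _ b) (\sum_(b in C) has_above _ b) (#|C|) (ncols C) (nrows C) => x y m i j; lia.
Qed.

Lemma sum_npred_components :
  (\sum_(b : T) npred [set: T] b + #|CC lam| = nboxes lam)%N.
Proof.
rewrite /nboxes -cardsT (card_partition CC_partition) -sum1_card.
rewrite -(eq_bigl _ _ (@in_setT T)) (set_partition_big _ CC_partition) /= -big_split /=.
by apply: eq_bigr => C compC; rewrite -(sum_npred_CC compC) addn1.
Qed.

End Components.

(** * Corners and the closed formulas *)

Local Open Scope ring_scope.

Section Corners.
Variables (r : nat) (lam : rshape r).
Local Notation T := (box lam).

Lemma exists_inT (P : pred T) : [exists a in [set: T], P a] = [exists a, P a].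
Proof. by apply: eq_existsb => a; rewrite inE. Qed.

Lemma minimalT_SC : minimal [set: T] = SC lam.
Proof.
apply/setP=> b; rewrite !inE npredE addn_eq0 !eqb0 /has_left /has_above.
by rewrite !exists_inT /= andbC.
Qed.

Lemma dullT_DC : dull [set: T] = DC lam.
Proof.
apply/setP=> b; rewrite !inE npredE nnwE eqb0 /has_left /has_above !exists_inT.
by case: [exists c, directly_left c b]; case: [exists c, directly_above c b].
Qed.

End Corners.

Section BrokenBorderStrip.
Variables (R : realType) (r : nat) (lam : rshape r).
Hypothesis n_gt0 : (0 < nboxes lam)%N.
Hypothesis no_nw : forall b, nnw [set: box lam] b = 0%N.
Local Notation T := (box lam).
Local Notation F := (ratfun R r).
Local Notation q := (qvar R r).
Local Notation cc := #|CC lam|.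
Implicit Types a b : T.

Lemma card_CC_gt0 : (0 < cc)%N.
Proof.
rewrite card_gt0; apply: contraTneq n_gt0 => CC0.
rewrite -leqNgt /nboxes -cardsT (card_partition (CC_partition lam)).
by rewrite CC0 big_set0.
Qed.

Lemma setT_box_neq0 : [set: T] != set0.
Proof. by rewrite -card_gt0 cardsT. Qed.

(** Two counts of the adjacent pairs among [N] boxes: [N - cc] by components and [N + #|DC| - #|SC|]
    by boxes. Thus [cc] is the difference [n - m] of [geometric_residue_sum]. *)
Lemma card_SC : #|SC lam| = (#|DC lam| + cc)%N.
Proof.
have := sum_npred_card (fun b (_ : b \in [set: T]) => no_nw b).
have := sum_npred_components no_nw.
rewrite minimalT_SC dullT_DC cardsT -/(nboxes lam) (eq_bigl _ _ (@in_setT T)).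
lia.
Qed.

(** Contents of neighbours differ by the factor [q ^+ 2] or [q ^- 2], and [q - q^-1] equals both
    [q (1 - q^-2)] and [- q^-1 (1 - q^2)]. *)
Lemma quotient_adj a b : adj a b -> (q - q^-1) / (ct R b - ct R a) =
  (if directly_left a b then q else - q^-1) / ct R b.
Proof.
have q0 := qvar_neq0 R r; have x0 := ct_neq0 R a; have y0 := qvar_sub_inv_neq0 R r.
move=> ab; have nz := ct_adj R ab; rewrite -subr_eq0 in nz.
apply/eqP; rewrite eqr_div ?ct_neq0 //; apply/eqP.
move: ab; rewrite /adj; have qq : q * q^-1 = 1 by rewrite mulfV.
case: ifP => /= [l _|_ u].
  rewrite (ct_left _ l); move: (q^-1) qq (ct R a) => p qp x.
  transitivity (x * q * (q ^+ 2 - q * p)); first by ring.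
  by rewrite qp; ring.
rewrite (ct_above _ u) -exprVn; move: (q^-1) qq (ct R a) => p qp x.
transitivity (x * p * (q * p - p ^+ 2)); first by ring.
by rewrite qp; ring.
Qed.

Lemma prod_quotient_adj b :
  \prod_(a | adj a b) ((q - q^-1) / (ct R b - ct R a)) =
  q ^+ has_left [set: T] b * (- q^-1) ^+ has_above [set: T] b *
  (ct R b)^-1 ^+ npred [set: T] b.
Proof.
rewrite (eq_bigr _ (fun a => @quotient_adj a b)) big_split /=; congr (_ * _).
  rewrite (bigID (fun a => directly_left a b)) /=; congr (_ * _).
    rewrite (eq_bigr (fun=> q)) => [|a /andP[_ ->]//].
    rewrite prodr_const /has_left -card_exists => [|a a']; last exact: left_funl.
    congr (_ ^+ _); apply: eq_card => a; rewrite !inE unfold_in /adj.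
    by case: (directly_left a b) => //=; rewrite andbF.
  rewrite (eq_bigr (fun=> - q^-1)) => [|a /andP[_ /negbTE->]//].
  rewrite prodr_const /has_above -card_exists => [|a a']; last exact: above_funl.
  congr (_ ^+ _); apply: eq_card => a; rewrite !inE unfold_in /adj.
  case l: (directly_left a b) => //=; last by rewrite andbT.
  by apply/esym/negP=> /and3P[_ /eqP ? _]; case/and3P: l => _ /eqP; lia.
by rewrite prodr_const; congr (_ ^+ _); apply: eq_card => a; rewrite !inE.
Qed.

(** Each adjacent pair absorbs one factor [q - q^-1], and [cc - 1] of them remain. The content of
    [b] is left with exponent [1 - npred b = - mobius b], nonzero only at corners, and the powers of
    [q] are collected by component. *)
Lemma greene_coeffE :
  (q - q^-1) ^+ (nboxes lam - 1) * (\prod_(b : T) ct R b) *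
    greene_coeff R [set: T] =
  (q - q^-1) ^+ (cc - 1) *
  (\prod_(s in SC lam) ct R s) * (\prod_(d in DC lam) (ct R d)^-1) *
  \prod_(bs in CC lam) (q ^+ (ncols bs - 1) * (- q^-1) ^+ (nrows bs - 1)).
Proof.
set y := q - q^-1.
have y0 : y != 0 by exact: qvar_sub_inv_neq0.
have inT (f : T -> F) : \prod_(b : T) f b = \prod_(b in [set: T]) f b.
  by apply: eq_bigl => b; rewrite inE.
have cE : y ^+ (\sum_(b : T) npred [set: T] b) * greene_coeff R [set: T] =
    \prod_(b : T) \prod_(a | adj a b) (y / (ct R b - ct R a)).
  rewrite /greene_coeff -inT -prodrXr -big_split /=; apply: eq_bigr => b _.
  rewrite [X in _ * (_ * X)]big_pred0 ?mulr1 => [|a]; last first.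
    by rewrite inE; apply/negbTE/northwest_absurd.
  rewrite big_split /= prodr_const; congr (_ ^+ _ * _).
    by apply: eq_card => a; rewrite !inE.
  by apply: eq_bigl => a; rewrite inE.
have nE : (nboxes lam - 1 = cc - 1 + \sum_(b : T) npred [set: T] b)%N.
  by rewrite -(sum_npred_components no_nw); have := card_CC_gt0; lia.
rewrite nE exprD mulrAC -[_ * _ * greene_coeff _ _]mulrA cE.
rewrite (eq_bigr _ (fun b _ => prod_quotient_adj b)).
have cornerE : (\prod_(b : T) ct R b) * \prod_(b : T) (ct R b)^-1 ^+ npred [set: T] b =
   (\prod_(s in SC lam) ct R s) * (\prod_(d in DC lam) (ct R d)^-1).
  rewrite -big_split /= inT.
  have := prod_mobius xpredT (fun b => (ct R b)^-1) (@upsetT _ lam).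
  rewrite !(eq_bigl _ _ (fun b => andbT _)) minimalT_SC dullT_DC.
  under [X in _ = X * _ -> _]eq_bigr do rewrite invrK.
  move=> <-; apply: eq_bigr => b _; rewrite /mobius no_nw subr0.
  by rewrite expfzDr ?invr_eq0 ?ct_neq0 // mulrC -exprnP exprN1 invrK.
have stripE : \prod_(b : T) (q ^+ has_left [set: T] b * (- q^-1) ^+ has_above [set: T] b) =
   \prod_(bs in CC lam) (q ^+ (ncols bs - 1) * (- q^-1) ^+ (nrows bs - 1)).
  rewrite inT (set_partition_big _ (CC_partition lam)) /=; apply: eq_bigr => C compC.
  have [<- <-] := sum_left_above_CC no_nw compC.
  by rewrite big_split /= !prodrXr.
rewrite big_split /= -stripE -[y ^+ (cc - 1) * _ * _ in RHS]mulrA -cornerE.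
move: (\prod_(b : T) ct R b) (\prod_(b : T) (_ * _)) (\prod_(b : T) (_ ^+ _)) (y ^+ _).
by move=> *; ring.
Qed.

Lemma prod_ct_inv (A : {set T}) :
  (\prod_(b in A) ct R b) * \prod_(b in A) (ct R b)^-1 = 1.
Proof.
by rewrite -big_split /=; apply: big1 => b _; rewrite mulfV ?ct_neq0.
Qed.

Lemma Delta_broken_border_strip0 :
  Delta R lam 0 = (q - q^-1) ^+ (cc - 1) *
    \prod_(bs in CC lam) (q ^+ (ncols bs - 1) * (- q^-1) ^+ (nrows bs - 1)).
Proof.
rewrite Delta_residues // greene_coeffE.
(* For [k = 0] the summand carries [1 / ct a], which is [partial_fractions] at [z = 0]; the
   resulting product cancels the corner contents of [greene_coeffE]. *)
have pf := partial_fractions (ct_minimal_inj (R := R) (@upsetT _ lam))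
  (card_dull_minimal setT_box_neq0 (fun b _ => no_nw b))
  (fun s _ => ct_neq0 R s).
under [X in _ * X = _]eq_bigr => a _ do rewrite expr0 mul1r -[X in X^-1]subr0.
rewrite pf minimalT_SC dullT_DC.
under [X in _ * (X * _)]eq_bigr do rewrite subr0.
under [X in _ * (_ * X)]eq_bigr do rewrite subr0.
have cancel (y a a' d d' p : F) : a * a' = 1 -> d * d' = 1 ->
    y * a * d' * p * (a' * d) = y * p.
  move=> aa' dd'; transitivity ((a * a') * (d * d') * (y * p)); first by ring.
  by rewrite aa' dd' !mul1r.
exact: cancel (prod_ct_inv _) (prod_ct_inv _).
Qed.

Lemma Delta_broken_border_strip k : (0 < k)%N ->
  Delta R lam k =
   (- q + q^-1) ^+ (cc - 1) *
   (\prod_(s in SC lam) ct R s) *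
   (\prod_(d in DC lam) (ct R d)^-1) *
   (\sum_(0 <= t < #|DC lam|.+1)
      (-1) ^+ t * e_ct R (DC lam) t * h_ct R (SC lam) (k%:Z - t%:Z - cc%:Z)) *
   \prod_(bs in CC lam) (q ^+ (ncols bs - 1) * (- q^-1) ^+ (nrows bs - 1)).
Proof.
case: k => // k _; rewrite Delta_residues // greene_coeffE.
have := card_SC; have := ct_minimal_inj (R := R) (@upsetT _ lam).
rewrite minimalT_SC dullT_DC => ctI cSC.
have ccE : cc = (#|SC lam| - #|DC lam|)%N by lia.
(* As the exponent is positive, dividing by [ct a] leaves a natural power, and the sum is a power
   sum of residues. *)
have resE : \sum_(a in SC lam) ct R a ^+ k.+1 / ct R a *
     (\prod_(b in SC lam :\ a) (ct R b - ct R a)^-1 *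
      \prod_(d in DC lam) (ct R d - ct R a)) =
   (-1) ^+ (cc - 1) * \sum_(0 <= t < #|DC lam|.+1)
      (-1) ^+ t * e_ct R (DC lam) t * h_ct R (SC lam) (k.+1%:Z - t%:Z - cc%:Z).
  rewrite ccE -(@geometric_residue_sum _ _ _ k (ct_vars R (B := SC lam))
                 (ct_vars R (B := DC lam))); first last.
  - by have := card_CC_gt0; lia.
  - by move=> i; apply: ct_neq0.
  - by move=> i j /ctI e; apply/enum_val_inj/e; apply: enum_valP.
  rewrite big_enum_val; apply: eq_bigr => i _.
  rewrite exprSr mulfK ?ct_neq0 //; congr (_ * (_ * _)); last by rewrite big_enum_val.
  transitivity (\prod_(b in SC lam | b != enum_val i) (ct R b - ct R (enum_val i))^-1).
    by apply: eq_bigl => b; rewrite in_setD1 andbC.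
  rewrite big_enum_val_cond; apply: eq_bigl => j.
  by rewrite (inj_eq enum_val_inj).
(* The sign [(-1) ^ (cc - 1)] turns [q - q^-1] into [- q + q^-1]. *)
rewrite resE (_ : - q + q^-1 = -1 * (q - q^-1)); last by ring.
rewrite [in RHS]exprMn.
by move: ((-1) ^+ (cc - 1)) (_ ^+ (cc - 1)) => *; ring.
Qed.

End BrokenBorderStrip.

Theorem theorem2p17 (R : realType) (r : nat) (hr : (0 < r)%N)
    (lam : rshape r) (hn : (1 <= nboxes lam)%N) :
  let q := qvar R r in
  let cc := #|CC lam| in
  (~~ broken_border_strip lam ->
     forall k : nat, (k <= r - 1)%N -> Delta R lam k = 0)
  /\
  (broken_border_strip lam ->
     Delta R lam 0 =
       (q - q^-1) ^+ (cc - 1) *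
       \prod_(bs in CC lam)
         (q ^+ (ncols bs - 1) * (- q^-1) ^+ (nrows bs - 1))
     /\
     forall k : nat, (1 <= k <= r - 1)%N ->
       Delta R lam k =
         (- q + q^-1) ^+ (cc - 1) *
         (\prod_(s in SC lam) ct R s) *
         (\prod_(d in DC lam) (ct R d)^-1) *
         (\sum_(0 <= t < #|DC lam|.+1)
            (-1) ^+ t * e_ct R (DC lam) t *
            h_ct R (SC lam) (k%:Z - t%:Z - cc%:Z)) *
         \prod_(bs in CC lam)
           (q ^+ (ncols bs - 1) * (- q^-1) ^+ (nrows bs - 1))).
Proof.
move=> q cc; rewrite /broken_border_strip has_2x2_blockE; split=> [|bbs].
  rewrite negbK => /existsP[a /existsP[d nw]] k _.
  by rewrite Delta_residues // (greene_coeff_eq0 R _ _ nw) ?inE // mulr0 mul0r.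
have no_nw b : nnw [set: box lam] b = 0%N.
  apply/eqP; rewrite nnwE eqb0; apply: contra bbs => /exists_inP[a _ ab].
  by apply/existsP; exists a; apply/existsP; exists b.
split=> [|k /andP[k0 _]]; first exact: Delta_broken_border_strip0.
exact: Delta_broken_border_strip.
Qed.
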